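(* Let $\psi:\Sigma\to\mathbb{L}^4$ be a marginally trapped surface with flat normal bundle. Then the quadratic differential $Q=(\tilde p-p)\,dz^2$ is holomorphic.
   Context: $\mathbb{L}^4$ is $\mathbb{R}^4$ with the metric $\langle,\rangle=-dx_0^2+dx_1^2+dx_2^2+dx_3^2$. A spacelike surface $\psi:\Sigma\to\mathbb{L}^4$ is an immersion of a connected orientable surface whose induced metric is Riemannian; $\Sigma$ is regarded as a Riemann surface with the induced conformal structure, and $z$ denotes a local conformal coordinate. It is marginally trapped if its mean curvature vector $\mathbf{H}$ satisfies $\langle\mathbf{H},\mathbf{H}\rangle=0$ (this includes $\mathbf H\equiv0$). Standing convention: for a marginally trapped surface the normal bundle is oriented so that $\mathbf{H}$ is everywhere a real multiple of $\eta+\tilde\eta$ for oriented orthonormal normal frames $\{\eta,\tilde\eta\}$ with $\eta$ spacelike and $\tilde\eta$ timelike with values in $\mathbb{H}^3=\{x:\langle x,x\rangle=-1,\ x_0>0\}$. It has flat normal bundle if the curvature of the normal connection vanishes identically; then locally there is such a frame $\{\eta,\tilde\eta\}$ which is moreover parallel in the normal bundle, unique up to constant hyperbolic rotations. With respect to such a parallel frame, $p=\langle\psi_{zz},\eta\rangle$ and $\tilde p=-\langle\psi_{zz},\tilde\eta\rangle$; a change of parallel frame multiplies $Q$ by a positive constant. *)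

(* Defs.v *)
From mathcomp Require Import all_boot all_order all_algebra.
From mathcomp Require Import all_classical all_reals topology normedtype derive.
From mathcomp Require Import complex.

Set Implicit Arguments.
Unset Strict Implicit.
Unset Printing Implicit Defensive.

Import Order.TTheory GRing.Theory Num.Theory.
Import numFieldNormedType.Exports.

Local Open Scope classical_set_scope.
Local Open Scope ring_scope.

(* -x_0 y_0 + x_1 y_1 + x_2 y_2 + x_3 y_3, bilinear over any K: with K = R it
   is the metric of L^4, with K = R[i] its complex-bilinear extension. *)
Definition mink (K : comNzRingType) (x y : 'rV[K]_4) : K :=
  - (x 0 0 * y 0 0) + \sum_(i < 3) x 0 (lift ord0 i) * y 0 (lift ord0 i).

Definition hyperbolic3 (R : realType) : set 'rV[R]_4 :=
  [set x | mink x x = -1 /\ 0 < x 0 0].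

Definition e1 (R : realType) : R * R := (1, 0).
Definition e2 (R : realType) : R * R := (0, 1).
Arguments e1 {R}.
Arguments e2 {R}.

Fixpoint Ck_on (R : realType) (V : normedModType R) (k : nat) (D : set (R * R))
    (f : R * R -> V) : Prop :=
  if k is k'.+1 then
    [/\ forall w, D w -> differentiable f w,
        Ck_on k' D ('D_e1 f) & Ck_on k' D ('D_e2 f)]
  else forall w, D w -> {for w, continuous f}.

(* Used on open sets D only; values of f outside D are irrelevant. *)
Definition smooth_on (R : realType) (V : normedModType R) (D : set (R * R))
    (f : R * R -> V) : Prop := forall k, Ck_on k D f.

(* A chart coord : dom -> R^2 with inverse param; both functions are total, and
   their values off dom and off its image carry no meaning. *)
Record chart (R : realType) (T : topologicalType) := Chart {
  dom : set T;
  coord : T -> R * R;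
  param : R * R -> T }.

Definition chart_img (R : realType) (T : topologicalType) (c : chart R T)
    (W : set T) : set (R * R) := coord c @` (dom c `&` W).

Definition is_chart (R : realType) (T : topologicalType) (c : chart R T) : Prop :=
  [/\ open (dom c), open (chart_img c setT),
      forall x, dom c x -> param c (coord c x) = x,
      forall x, dom c x -> {for x, continuous (coord c)} &
      forall w, chart_img c setT w -> {for w, continuous (param c)}].

Definition jacobian (R : realType) (tau : R * R -> R * R) (w : R * R) : R :=
  ('D_e1 tau w).1 * ('D_e2 tau w).2 - ('D_e1 tau w).2 * ('D_e2 tau w).1.

Definition oriented_transition (R : realType) (T : topologicalType)
    (c c' : chart R T) : Prop :=
  smooth_on (chart_img c (dom c')) (coord c' \o param c) /\
  forall w, chart_img c (dom c') w -> 0 < jacobian (coord c' \o param c) w.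

(* A is a maximal oriented smooth atlas. *)
Definition oriented_structure (R : realType) (T : topologicalType)
    (A : set (chart R T)) : Prop :=
  [/\ forall c, A c -> is_chart c,
      forall x, exists2 c, A c & dom c x,
      forall c c', A c -> A c' -> oriented_transition c c' &
      forall c, is_chart c ->
        (forall c', A c' -> oriented_transition c c' /\ oriented_transition c' c) ->
        A c].

Definition connected_oriented_surface (R : realType) (T : topologicalType)
    (A : set (chart R T)) : Prop :=
  [/\ hausdorff_space T, @second_countable T, connected [set: T] &
      oriented_structure A].

(* Below, f : R * R -> L^4 is a local parametrization psi \o param c. *)

Definition metric (R : realType) (f : R * R -> 'rV[R]_4) (w v v' : R * R) : R :=
  mink ('D_v f w) ('D_v' f w).

(* Positive definiteness of the induced metric forces the differential to be
   injective, so psi is an immersion. *)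
Definition spacelike_surface (R : realType) (T : topologicalType)
    (A : set (chart R T)) (psi : T -> 'rV[R]_4) : Prop :=
  forall c, A c ->
    smooth_on (chart_img c setT) (psi \o param c) /\
    forall w, chart_img c setT w -> forall v : R * R, v != 0 ->
      0 < metric (psi \o param c) w v v.

Definition gram (R : realType) (f : R * R -> 'rV[R]_4) (w : R * R) : R :=
  metric f w e1 e1 * metric f w e2 e2 - metric f w e1 e2 ^+ 2.

(* The vector a f_u + b f_v with (a, b) solving the Gram system
   a E + b F = <x, f_u>, a F + b G = <x, f_v>. *)
Definition tangent_part (R : realType) (f : R * R -> 'rV[R]_4) (w : R * R)
    (x : 'rV[R]_4) : 'rV[R]_4 :=
  let fu := 'D_e1 f w in let fv := 'D_e2 f w in
  ((mink x fu * metric f w e2 e2 - mink x fv * metric f w e1 e2) / gram f w) *: fu +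
  ((mink x fv * metric f w e1 e1 - mink x fu * metric f w e1 e2) / gram f w) *: fv.

Definition normal_part (R : realType) (f : R * R -> 'rV[R]_4) (w : R * R)
    (x : 'rV[R]_4) : 'rV[R]_4 := x - tangent_part f w x.

Definition second_form (R : realType) (f : R * R -> 'rV[R]_4) (w v v' : R * R) :
    'rV[R]_4 := normal_part f w ('D_v ('D_v' f) w).

(* Half the metric trace of the second fundamental form. *)
Definition mean_curvature (R : realType) (f : R * R -> 'rV[R]_4) (w : R * R) :
    'rV[R]_4 :=
  (2 * gram f w)^-1 *:
    (metric f w e2 e2 *: second_form f w e1 e1
     - (2 * metric f w e1 e2) *: second_form f w e1 e2
     + metric f w e1 e1 *: second_form f w e2 e2).

Definition marginally_trapped (R : realType) (T : topologicalType)
    (A : set (chart R T)) (psi : T -> 'rV[R]_4) : Prop :=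
  forall c, A c -> forall w, chart_img c setT w ->
    let H := mean_curvature (psi \o param c) w in mink H H = 0.

Definition is_normal (R : realType) (f : R * R -> 'rV[R]_4) (w : R * R)
    (x : 'rV[R]_4) : Prop := forall v : R * R, mink x ('D_v f w) = 0.

(* The normal connection applied to a section X along f. *)
Definition normal_conn (R : realType) (f : R * R -> 'rV[R]_4) (v : R * R)
    (X : R * R -> 'rV[R]_4) (w : R * R) : 'rV[R]_4 := normal_part f w ('D_v X w).

(* R(d_u, d_v) X = 0 for every local normal section X; the term in [d_u, d_v] is
   absent since coordinate fields commute, and d_u, d_v span the tangent plane. *)
Definition flat_normal_bundle (R : realType) (T : topologicalType)
    (A : set (chart R T)) (psi : T -> 'rV[R]_4) : Prop :=
  forall c, A c -> forall X : R * R -> 'rV[R]_4,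
    let f := psi \o param c in
    smooth_on (chart_img c setT) X ->
    (forall w, chart_img c setT w -> is_normal f w (X w)) ->
    forall w, chart_img c setT w ->
      normal_conn f e1 (normal_conn f e2 X) w -
      normal_conn f e2 (normal_conn f e1 X) w = 0.

Definition rows4 (R : realType) (a b c d : 'rV[R]_4) : 'M[R]_4 :=
  \matrix_(i < 4) nth 0 [:: a; b; c; d] i.

(* The surface being connected and oriented, its normal bundle has exactly two
   orientations: (n, m) is positive when (-1)^s det (f_u, f_v, n, m) > 0, for
   s = false or s = true. *)
Definition oriented_normal_frame (R : realType) (s : bool)
    (f : R * R -> 'rV[R]_4) (w : R * R) (n m : 'rV[R]_4) : Prop :=
  [/\ is_normal f w n /\ is_normal f w m,
      mink n n = 1, mink n m = 0, hyperbolic3 m &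
      0 < (-1) ^+ s * \det (rows4 ('D_e1 f w) ('D_e2 f w) n m)].

(* s is a normal orientation for which H is everywhere a real multiple of the
   sum of the members of any oriented orthonormal normal frame. *)
Definition trapped_orientation (R : realType) (T : topologicalType)
    (A : set (chart R T)) (psi : T -> 'rV[R]_4) (s : bool) : Prop :=
  forall c, A c -> forall w, chart_img c setT w -> forall n m : 'rV[R]_4,
    oriented_normal_frame s (psi \o param c) w n m ->
    exists k : R, mean_curvature (psi \o param c) w = k *: (n + m).

(* A smooth parallel oriented orthonormal frame of the normal bundle over W. *)
Definition parallel_normal_frame (R : realType) (T : topologicalType)
    (A : set (chart R T)) (psi : T -> 'rV[R]_4) (s : bool) (W : set T)
    (eta etat : T -> 'rV[R]_4) : Prop :=
  forall c, A c ->
    let f := psi \o param c in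
    [/\ smooth_on (chart_img c W) (eta \o param c),
        smooth_on (chart_img c W) (etat \o param c),
        forall w, chart_img c W w ->
          oriented_normal_frame s f w (eta (param c w)) (etat (param c w)) &
        forall w, chart_img c W w -> forall v : R * R,
          normal_conn f v (eta \o param c) w = 0 /\
          normal_conn f v (etat \o param c) w = 0].

Definition conformal (R : realType) (T : topologicalType)
    (psi : T -> 'rV[R]_4) (c : chart R T) : Prop :=
  forall w, chart_img c setT w ->
    metric (psi \o param c) w e1 e1 = metric (psi \o param c) w e2 e2 /\
    metric (psi \o param c) w e1 e2 = 0.

(* The complex coordinate is z = u + i v. *)
Definition toC (R : realType) (w : R * R) : R[i] := Complex w.1 w.2.
Definition ofC (R : realType) (z : R[i]) : R * R := (complex.Re z, complex.Im z).

(* f_zz = (f_uu - f_vv - 2 i f_uv) / 4, that is, d/dz = (d/du - i d/dv) / 2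
   applied twice. *)
Definition dzz (R : realType) (f : R * R -> 'rV[R]_4) (w : R * R) :
    'rV[R[i]]_4 :=
  \row_j Complex (('D_e1 ('D_e1 f) w 0 j - 'D_e2 ('D_e2 f) w 0 j) / 4)
                 (- ('D_e1 ('D_e2 f) w 0 j / 2)).

Definition complexify (R : realType) (x : 'rV[R]_4) : 'rV[R[i]]_4 :=
  map_mx (real_complex R) x.

Definition p_coef (R : realType) (T : topologicalType) (psi : T -> 'rV[R]_4)
    (eta : T -> 'rV[R]_4) (c : chart R T) (z : R[i]) : R[i] :=
  mink (dzz (psi \o param c) (ofC z)) (complexify (eta (param c (ofC z)))).

Definition pt_coef (R : realType) (T : topologicalType) (psi : T -> 'rV[R]_4)
    (etat : T -> 'rV[R]_4) (c : chart R T) (z : R[i]) : R[i] :=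
  - mink (dzz (psi \o param c) (ofC z)) (complexify (etat (param c (ofC z)))).

(* Coefficient of Q = (pt - p) dz^2 in the coordinate c. *)
Definition Q_coef (R : realType) (T : topologicalType) (psi : T -> 'rV[R]_4)
    (eta etat : T -> 'rV[R]_4) (c : chart R T) (z : R[i]) : R[i] :=
  pt_coef psi etat c z - p_coef psi eta c z.

Definition transition (R : realType) (T : topologicalType) (c c' : chart R T)
    (z : R[i]) : R[i] := toC (coord c' (param c (ofC z))).

(* The coefficients q c, one for each conformal coordinate c of the Riemann
   surface, define on W a quadratic differential q c dz^2 (first clause) which
   is holomorphic (second clause; derivability is over R[i]). *)
Definition holomorphic_quadratic_differential (R : realType)
    (T : topologicalType) (A : set (chart R T)) (psi : T -> 'rV[R]_4)
    (W : set T) (q : chart R T -> R[i] -> R[i]) : Prop :=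
  (forall c c', A c -> A c' -> conformal psi c -> conformal psi c' ->
     forall z : R[i], chart_img c (dom c' `&` W) (ofC z) ->
       q c z = q c' (transition c c' z) *
         ('D_1 (transition c c' : R[i]^o -> R[i]^o) z : R[i]) ^+ 2) /\
  (forall c, A c -> conformal psi c ->
     forall z : R[i], chart_img c W (ofC z) ->
       derivable (q c : R[i]^o -> R[i]^o) z 1).

(* Main.v *)
Require Import Defs.
From mathcomp Require Import all_boot all_order all_algebra.
From mathcomp Require Import all_classical all_reals topology normedtype derive.
From mathcomp Require Import complex.
From mathcomp Require Import landau ring lra.

Set Implicit Arguments.
Unset Strict Implicit.
Unset Printing Implicit Defensive.

Import Order.TTheory GRing.Theory Num.Theory.
Import numFieldNormedType.Exports.
Import ComplexField.

Local Open Scope classical_set_scope.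
Local Open Scope ring_scope.

(** Put N = eta + etat, a null parallel normal field, so that Q = - <psi_zz, N> dz^2.
    Since H is a multiple of N, <H, N> = 0, which in a conformal coordinate says
    <psi_uu + psi_vv, N> = 0.  With l_ij = <psi_i, N_j> = - <psi_ij, N> this gives
    l_11 = - l_22 and Q = (l_11 / 2 - i l_21 / 2) dz^2.  The Cauchy-Riemann
    equations for this coefficient are the Codazzi equations of the shape operator
    of N: N_u and N_v are tangent because N is parallel, and psi_uv and N_uv are
    symmetric, so only the derivatives of the conformality relations are needed.
    A transition between conformal coordinates preserves orientation and is
    therefore holomorphic; as l_ij involves first derivatives only, the chain rule
    gives the transformation law. *)

(** * Symmetry of second derivatives *)

Lemma is_derive_line (R : realType) (V W : normedModType R) (g : V -> W)
    (a y : V) (x : R) : differentiable g (x *: a + y) ->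
  is_derive x 1 (fun t => g (t *: a + y)) ('D_a g (x *: a + y)).
Proof.
move=> dg.
have dl : is_diff x (fun t : R => t *: a + y) ( *:%R^~ a).
  have := is_diffD (is_diff_scalel x a) (is_diff_cst y x).
  by rewrite addr0.
have dl' : differentiable (fun t : R => t *: a + y) x by case: dl.
have dc : differentiable (g \o (fun t : R => t *: a + y)) x.
  exact: differentiable_comp.
split; first exact: diff_derivable.
rewrite deriveE // diff_comp // (deriveE _ dg) /=.
by case: dl => _ ->; rewrite scale1r.
Qed.

(** The increment of [g] around the parallelogram with sides [t a] and [t b] at [w], bracketed as a
    difference along [a] of differences along [b]. *)
Definition second_difference (R : realType) (V : normedModType R) (g : V -> R)
    (w a b : V) (t : R) : R :=
  g (t *: a + (t *: b + w)) - g (t *: b + w) - (g (t *: a + w) - g w).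

Lemma second_differenceC (R : realType) (V : normedModType R) (g : V -> R)
    (w a b : V) (t : R) :
  second_difference g w a b t = second_difference g w b a t.
Proof. by rewrite /second_difference addrCA; ring. Qed.

(* The mean value theorem applied to x |-> g (x a + t b + w) - g (x a + w). *)
Lemma cvg_second_difference (R : realType) (V : normedModType R) (g : V -> R)
    (w a b : V) :
  (\forall x \near w, differentiable g x) -> differentiable ('D_a g) w ->
  t ^- 2 * second_difference g w a b t @[t --> 0^'+] --> 'D_b ('D_a g) w.
Proof.
move=> dg dG; apply/cvgrPdist_le => /= e e0.
set G := 'D_a g in dG *.
(* The summand 1 keeps [K] positive when [a = b = 0]. The tolerance [e / (2 * K)] is used at two
   points, each error then being at most [t * e / 2]. *)
pose K := `|a| + `|b| + 1.
have K0 : 0 < K by rewrite /K ltr_wpDl // addr_ge0.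
have e'0 : 0 < e / (2 * K) by rewrite divr_gt0 // mulr_gt0.
have [r /= r0 Hr] : exists2 r : R, 0 < r & forall k, `|k| < r ->
    differentiable g (k + w) /\ `|G (k + w) - G w - 'd G w k| <= e / (2 * K) * `|k|.
  have H1 : \forall k \near (0 : V), differentiable g (k + w).
    by have := dg; rewrite (near_shift 0 w) subr0.
  have H2 : \forall k \near (0 : V),
      `|G (k + w) - G w - 'd G w k| <= e / (2 * K) * `|k|.
    have := iffLR (eqaddoP _ _ _ _) (diff_locally dG) _ e'0.
    by apply: filterS => k /=; rewrite !fctE /= opprD addrA.
  have [r /= r0 H] := (iffLR (nbhs_normP _ _) (filterI H1 H2)).
  by exists r => // k kr; apply: H; rewrite /= sub0r normrN.
near=> t.
have t0 : 0 < t by near: t; exact: nbhs_right_gt.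
have tr : t < r / K by near: t; apply: nbhs_right_lt; exact: divr_gt0.
have tK : t * K < r by rewrite -ltr_pdivlMr.
have small (x y : R) : `|x| <= t -> `|y| <= t -> `|x *: a + y *: b| <= t * (`|a| + `|b|).
  move=> xt yt; apply: le_trans (ler_normD _ _) _.
  by rewrite !normrZ mulrDr lerD // ler_wpM2r.
have small' : t * (`|a| + `|b|) < r.
  by apply: le_lt_trans tK; rewrite ler_pM2l // /K lerDl.
have n0 : `|0 : R| <= t by rewrite normr0 ltW.
have nt : `|t| <= t by rewrite gtr0_norm.
pose phi x := g (x *: a + (t *: b + w)) - g (x *: a + w).
have dphi x : x \in `[0, t] ->
    is_derive x 1 phi (G (x *: a + (t *: b + w)) - G (x *: a + w)).
  rewrite in_itv /= => /andP[x0 xt].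
  have nx : `|x| <= t by rewrite ger0_norm.
  apply: is_deriveB; apply: is_derive_line.
    by rewrite addrA; apply: (Hr _ (le_lt_trans (small _ _ nx nt) small')).1.
  have := (Hr _ (le_lt_trans (small _ _ nx n0) small')).1.
  by rewrite scale0r addr0.
have dphi' x : x \in `]0, t[ ->
    is_derive x 1 phi (G (x *: a + (t *: b + w)) - G (x *: a + w)).
  by rewrite in_itv /= => /andP[? ?]; apply: dphi; rewrite in_itv /= !ltW.
have cphi : {within `[0, t], continuous phi}.
  by apply: derivable_within_continuous => x /dphi [].
have [c] := MVT t0 dphi' cphi.
rewrite in_itv /= => /andP[c0 ct] mvt.
have -> : second_difference g w a b t = phi t - phi 0.
  by rewrite /second_difference /phi !scale0r !add0r; ring.
rewrite mvt subr0 -/G.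
have nc : `|c| <= t by rewrite gtr0_norm // ltW.
have [_ E1] := Hr _ (le_lt_trans (small _ _ nc nt) small').
have [_ E2] := Hr _ (le_lt_trans (small _ _ nc n0) small').
rewrite scale0r addr0 in E2.
(* Expanding [G] at both points to first order, the terms in [c] cancel in the difference and
   [t * 'd G w b] remains. *)
have D1 : 'd G w (c *: a + t *: b) = c * 'd G w a + t * 'd G w b.
  by rewrite linearD !linearZ.
have D2 : 'd G w (c *: a) = c * 'd G w a by rewrite linearZ.
rewrite deriveE //; rewrite D1 -(addrA (c *: a)) in E1; rewrite D2 in E2.
set p := G _ in E1 *; set q := G _ in E2 *; set o := G w in E1 E2.
have := small _ _ nc nt; have := small _ _ nc n0; rewrite scale0r addr0 => S2 S1.
have F1 := le_trans E1 (ler_wpM2l (ltW e'0) S1).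
have F2 := le_trans E2 (ler_wpM2l (ltW e'0) S2).
have tn0 : t != 0 by rewrite gt_eqF.
rewrite [X in `|X|](_ : _ = t^-1 * (t * 'd G w b - (p - q))); last by field.
rewrite normrM gtr0_norm ?invr_gt0 // ler_pdivrMl //.
have K' : e / (2 * K) * (t * (`|a| + `|b|)) <= t * e / 2.
  have -> : t * e / 2 = e / (2 * K) * (t * K) by field; rewrite gt_eqF.
  by rewrite ler_pM2l // ler_pM2l // /K lerDl.
move: F1 F2 K'; rewrite !ler_norml => /andP[? ?] /andP[? ?] ?.
by apply/andP; split; lra.
Unshelve. all: by end_near. Qed.

(** The second difference is symmetric in [a] and [b], so its quotient by [t ^ 2] converges to both
    mixed derivatives. Differentiability of the first derivatives at the single point [w] is
    enough. *)
Lemma derive_comm (R : realType) (V : normedModType R) (g : V -> R) (w a b : V) :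
  (\forall x \near w, differentiable g x) ->
  differentiable ('D_a g) w -> differentiable ('D_b g) w ->
  'D_a ('D_b g) w = 'D_b ('D_a g) w.
Proof.
move=> dg da db; have Ha := cvg_second_difference (b := b) dg da.
have := cvg_second_difference (b := a) dg db.
under eq_fun do rewrite second_differenceC.
move=> Hb; exact: (cvg_unique _ Hb Ha).
Qed.

(** The first-order expansion at [w] sees only values near [w], so ['d f w] also serves as the
    differential of [g]. This handles identities between derivatives that hold only on an open
    set. *)
Lemma near_eq_differentiable (R : numFieldType) (V W : normedModType R)
    (f g : V -> W) (w : V) :
  (\forall x \near w, f x = g x) -> differentiable f w -> differentiable g w.
Proof.
move=> fg df; have fgw := nbhs_singleton fg.
have /diff_locally/(iffLR (eqaddoP _ _ _ _)) Ef := df.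
have cdf := diff_continuous df.
have Eg : g \o shift w = cst (g w) + 'd f w +o_ 0 id.
  apply: (iffRL (eqaddoP _ _ _ _)) => e e0.
  have := fg; rewrite (near_shift 0 w) subr0 => fg0.
  apply: filterS2 fg0 (Ef e e0) => x /= fgx.
  by rewrite !fctE /= fgx fgw.
apply/diff_locallyP; rewrite (diff_unique cdf Eg); split => //.
Qed.

Lemma is_derive_coord (R : realType) (V : normedModType R) m n
    (F : V -> 'M[R]_(m, n)) (w v : V) i j :
  derivable F w v -> is_derive w v (fun x => F x i j) ('D_v F w i j).
Proof.
move=> dF; rewrite derive_mx // mxE; apply: derivableP.
exact: (iffLR (derivable_mxP _ _ _) dF).
Qed.

Lemma differentiable_entry (R : realType) (V : normedModType R) m n
    (F : V -> 'M[R]_(m, n)) (w : V) i j :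
  differentiable F w -> differentiable (fun x => F x i j) w.
Proof.
move=> dF; have := differentiable_comp dF (differentiable_coord (F w) i j).
exact.
Qed.

Lemma derive_comm_mx (R : realType) (V : normedModType R) m n
    (F : V -> 'M[R]_(m, n)) (w a b : V) :
  (\forall x \near w, differentiable F x) ->
  differentiable ('D_a F) w -> differentiable ('D_b F) w ->
  'D_a ('D_b F) w = 'D_b ('D_a F) w.
Proof.
move=> dF da db; apply/matrixP => i j.
pose g (x : V) : R := F x i j.
have dg : \forall x \near w, differentiable g x.
  by apply: filterS dF => x; exact: differentiable_entry.
have coordD v : \forall x \near w, 'D_v F x i j = 'D_v g x.
  apply: filterS dF => x dFx; have dv : derivable F x v by exact: diff_derivable.
  by case: (is_derive_coord i j dv) => _ ->.
have dD v : differentiable ('D_v F) w -> differentiable ('D_v g) w.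
  by move=> /(differentiable_entry i j); exact: near_eq_differentiable.
have Dg := derive_comm dg (dD _ da) (dD _ db).
have dE u v : differentiable ('D_v F) w -> 'D_u ('D_v F) w i j = 'D_u ('D_v g) w.
  move=> d; rewrite -(near_eq_derive u (coordD v)).
  have du : derivable ('D_v F) w u by exact: diff_derivable.
  by case: (is_derive_coord i j du) => _ ->.
have E1 := dE a b db.
have E2 := dE b a da.
exact: etrans E1 (etrans Dg (esym E2)).
Qed.

(** * The Minkowski form and its product rule *)

Section mink.
Variable K : comNzRingType.
Implicit Types (x y z : 'rV[K]_4) (a : K).

Lemma minkC x y : mink x y = mink y x.
Proof. by rewrite /mink mulrC; under eq_bigr do rewrite mulrC. Qed.

Lemma minkDl x y z : mink (x + y) z = mink x z + mink y z.
Proof. by rewrite /mink !mxE !big_ord_recl !big_ord0 !mxE; ring. Qed.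

Lemma minkZl a x y : mink (a *: x) y = a * mink x y.
Proof. by rewrite /mink !mxE !big_ord_recl !big_ord0 !mxE; ring. Qed.

Lemma minkNl x y : mink (- x) y = - mink x y.
Proof. by rewrite -scaleN1r minkZl mulN1r. Qed.

Lemma minkDr x y z : mink x (y + z) = mink x y + mink x z.
Proof. by rewrite ![mink x _]minkC minkDl. Qed.

Lemma minkZr a x y : mink x (a *: y) = a * mink x y.
Proof. by rewrite ![mink x _]minkC minkZl. Qed.

End mink.

Lemma is_derive_mink (R : realType) (V : normedModType R)
    (X Y : V -> 'rV[R]_4) (w v : V) :
  derivable X w v -> derivable Y w v ->
  is_derive w v (fun x => mink (X x) (Y x))
    (mink ('D_v X w) (Y w) + mink (X w) ('D_v Y w)).
Proof.
move=> dX dY.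
have dc i : is_derive w v (fun x => X x 0 i * Y x 0 i)
    ('D_v X w 0 i * Y w 0 i + X w 0 i * 'D_v Y w 0 i).
  have := is_deriveM (is_derive_coord 0 i dX) (is_derive_coord 0 i dY).
  by move=> h; apply: is_derive_eq h _; rewrite addrC /GRing.scale /=; ring.
have -> : (fun x => mink (X x) (Y x)) = - (fun x => X x 0 0 * Y x 0 0) +
    \sum_(i < 3) (fun x => X x 0 (lift ord0 i) * Y x 0 (lift ord0 i)).
  by apply/funext => x; rewrite /mink !fctE /= fct_sumE.
apply: is_derive_eq.
by rewrite /mink -addrACA -opprD -big_split.
Qed.

Lemma differentiable_mink (R : realType) (V : normedModType R)
    (X Y : V -> 'rV[R]_4) (w : V) :
  differentiable X w -> differentiable Y w ->
  differentiable (fun x => mink (X x) (Y x)) w.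
Proof.
move=> dX dY.
have dc i : differentiable (fun x => X x 0 i * Y x 0 i) w.
  exact: differentiableM (differentiable_entry 0 i dX) (differentiable_entry 0 i dY).
apply: differentiableD; first exact: differentiableN.
by have := differentiable_sum (fun i => dc (lift ord0 i)); rewrite fct_sumE.
Qed.

(** * Cauchy-Riemann equations and regularity in the plane *)

Lemma derive_basis (R : realType) (V : normedModType R) (F : R * R -> V)
    (w v : R * R) : differentiable F w ->
  'D_v F w = v.1 *: 'D_e1 F w + v.2 *: 'D_e2 F w.
Proof.
move=> dF; rewrite !deriveE // -!linearZ -linearD; congr ('d F w _).
case: v => a b; apply/pair_equal_spec.
by split; rewrite /= /GRing.scale /= ?mulr1 ?mulr0 ?addr0 ?add0r.
Qed.

(** The norm on [R * R] is the maximum norm; 2 is a crude substitute for the optimal constant, the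
    square root of 2. *)
Lemma normC_toC_le (R : realType) (v : R * R) : `|toC v| <= (2 * `|v|)%:C%C.
Proof.
rewrite normc_def lecR /= mulr2n mulrDl mul1r.
have n0 : 0 <= `|v| by [].
have [h1 h2] : `|v.1| <= `|v| /\ `|v.2| <= `|v|.
  by rewrite prod_normE !le_max !lexx orbT.
rewrite -[leRHS]ger0_norm ?addr_ge0 // -sqrtr_sqr; apply: ler_wsqrtr.
move: h1 h2; rewrite !ler_norml => /andP[? ?] /andP[? ?].
nra.
Qed.

Lemma norm_ofC_le (R : realType) (z : R[i]) : (`|ofC z|)%:C%C <= `|z|.
Proof.
rewrite normc_def lecR prod_normE ge_max /= -!(sqrtr_sqr (_ z)).
by rewrite !ler_wsqrtr // ?lerDl ?lerDr sqr_ge0.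
Qed.

(** Under the Cauchy-Riemann equations the real differential of [F] is multiplication by the complex
    number [toC ('D_e1 F (ofC z))], so the real first-order expansion is already the complex one. *)
Lemma cauchy_riemann_is_derive (R : realType) (F : R * R -> R * R) (z : R[i]) :
  differentiable F (ofC z) ->
  ('D_e1 F (ofC z)).1 = ('D_e2 F (ofC z)).2 ->
  ('D_e1 F (ofC z)).2 = - ('D_e2 F (ofC z)).1 ->
  is_derive (z : R[i]^o) 1 ((fun y => toC (F (ofC y))) : R[i]^o -> R[i]^o)
    (toC ('D_e1 F (ofC z))).
Proof.
move=> dF CR1 CR2.
set l := toC _; set f : R[i]^o -> R[i]^o := fun y => _.
suff H : h^-1 *: ((f \o shift (z : R[i]^o)) (h *: (1 : R[i]^o)) - f z)
    @[h --> (0 : R[i]^o)^'] --> (l : R[i]^o).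
  split; first by apply/cvg_ex; exists l.
  by apply: cvg_lim => //; exact: norm_hausdorff.
apply/cvgrPdist_le => /= e e0.
(* In the order of [R[i]] a positive element has zero imaginary part. *)
have [d d0 de] : exists2 d : R, 0 < d & e = d%:C%C.
  by case: e e0 => a b /= ; rewrite ltcE /= => /andP[/eqP -> ?]; exists a.
(* Half of [d] compensates the factor 2 in [normC_toC_le]. *)
have /diff_locally/(iffLR (eqaddoP _ _ _ _))/(_ (d / 2)) := dF.
rewrite divr_gt0 // => /(_ isT) /nbhs_normP [r /= r0 Hr].
near=> h.
have h0 : h != 0 by near: h; exact: (@nbhs_dnbhs_neq R[i]^o).
have hr : `|h| < r%:C%C by near: h; apply: (@dnbhs0_lt R[i] R[i]^o); rewrite ltcR.
have := Hr (ofC h); rewrite /= sub0r normrN => /(_ _).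
rewrite -ltcR => /(_ (le_lt_trans (norm_ofC_le h) hr)).
rewrite !fctE /= -(deriveE _ dF) derive_basis // => E.
set k := F _ - _ in E.
have hE : ofC (h *: (1 : R[i]^o) + z) = ofC h + ofC z.
  by rewrite /GRing.scale /= mulr1; case: (h) => ? ?; case: (z).
have toCB x y : toC (x - y) = toC x - toC y :> R[i] by [].
have toCD x y : toC (x + y) = toC x + toC y :> R[i] by [].
have lE : h * l = toC ((ofC h).1 *: 'D_e1 F (ofC z) + (ofC h).2 *: 'D_e2 F (ofC z)).
  rewrite /l; case: (h) => a b; move: CR1 CR2.
  case: ('D_e1 F (ofC z)) => p q; case: ('D_e2 F (ofC z)) => p' q' /= -> ->.
  apply/eqP; rewrite eq_complex /= /GRing.scale /=.
  by apply/andP; split; apply/eqP; ring.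
have <- : h^-1 * toC (- k) = l - h^-1 *: (f (h *: 1 + z) - f z).
  rewrite -[X in X - _](mulKf h0) lE /GRing.scale /= -mulrBr; congr (_ * _).
  by rewrite /f hE /k opprB toCB toCD opprB addrA [X in _ = X - _]addrC.
rewrite normrM normfV ler_pdivrMl ?normr_gt0 // de.
apply: le_trans (normC_toC_le _) _; rewrite normrN.
apply: (@le_trans _ _ (d * `|ofC h|)%:C%C).
  have half x : d * x = 2 * (d / 2 * x) by field.
  by rewrite lecR half ler_pM2l.
rewrite rmorphM mulrC; apply: ler_wpM2r; first by rewrite lecR ltW.
exact: norm_ofC_le.
Unshelve. all: by end_near. Qed.

(** Two orders of differentiability carry the Codazzi computation, and they pass easily from [eta]
    and [etat] to their sum. *)
Definition twice_differentiable_on (R : realType) (V : normedModType R)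
    (D : set (R * R)) (F : R * R -> V) : Prop :=
  forall w, D w -> [/\ differentiable F w, differentiable ('D_e1 F) w &
    differentiable ('D_e2 F) w].

Lemma smooth_on_twice (R : realType) (V : normedModType R) (D D' : set (R * R))
    (F : R * R -> V) :
  D' `<=` D -> smooth_on D F -> twice_differentiable_on D' F.
Proof.
move=> DD /(_ 2) [d0 [d1 _ _] [d2 _ _]] w /DD Dw.
by split; [apply: d0|apply: d1|apply: d2].
Qed.

Lemma twice_differentiable_onD (R : realType) (V : normedModType R)
    (D : set (R * R)) (X Y : R * R -> V) : open D ->
  twice_differentiable_on D X -> twice_differentiable_on D Y ->
  twice_differentiable_on D (X + Y).
Proof.
move=> oD dX dY w Dw.
have DD v : \forall x \near w, ('D_v X + 'D_v Y) x = 'D_v (X + Y) x.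
  have := open_nbhs_nbhs (conj oD Dw); apply: filterS => x Dx.
  have [? _ _] := dX x Dx; have [? _ _] := dY x Dx.
  by rewrite deriveD //; exact: diff_derivable.
have [X0 X1 X2] := dX w Dw; have [Y0 Y1 Y2] := dY w Dw.
split; first exact: differentiableD.
  by apply: near_eq_differentiable (DD e1) _; exact: differentiableD.
by apply: near_eq_differentiable (DD e2) _; exact: differentiableD.
Qed.

Lemma twice_differentiable_comm (R : realType) m n (D : set (R * R))
    (F : R * R -> 'M[R]_(m, n)) (w : R * R) : open D ->
  twice_differentiable_on D F -> D w -> 'D_e1 ('D_e2 F) w = 'D_e2 ('D_e1 F) w.
Proof.
move=> oD dF Dw; have [_ d1 d2] := dF w Dw.
apply: derive_comm_mx => //; have := open_nbhs_nbhs (conj oD Dw).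
by apply: filterS => x /dF [].
Qed.

(** * Codazzi equations of a parallel normal field *)

Lemma mink_polar (R : realType) (x y x' y' : 'rV[R]_4) :
  mink x' x + mink x x' = mink y' y + mink y y' -> mink x' x = mink y' y.
Proof. by rewrite ![mink _ x']minkC ![mink _ y']minkC => h; lra. Qed.

(** Here [x_i], [n_i] are first derivatives of the surface and of the normal field, [x_ij] second
    derivatives, and [l] is the inverse conformal factor. Substituting the tangential expansions of
    [n1] and [n2], the differentiated conformality relations turn both sides of each identity into
    the same combination of [mink x21 x1] and [mink x21 x2], or of [mink x22 x1] and
    [mink x22 x2]. *)
Lemma codazzi_algebra (R : realType) (l : R) (x1 x2 n1 n2 x11 x21 x22 : 'rV[R]_4) :
  n1 = l *: (mink x1 n1 *: x1 + mink x2 n1 *: x2) ->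
  n2 = l *: (mink x1 n2 *: x1 + mink x2 n2 *: x2) ->
  mink x1 n2 = mink x2 n1 -> mink x2 n2 = - mink x1 n1 ->
  mink x11 x1 = mink x21 x2 -> mink x11 x2 = - mink x21 x1 ->
  mink x22 x2 = mink x21 x1 -> mink x22 x1 = - mink x21 x2 ->
  mink x21 n1 = mink x11 n2 /\ mink x21 n2 = mink x22 n1.
Proof.
move=> E1 E2 M L C1 C2 C3 C4; rewrite M L in E2; move: E1 E2.
move: (mink x1 n1) (mink x2 n1) => p q -> ->.
by split; rewrite !minkZr !minkDr !minkZr ?C1 ?C2 ?C3 ?C4; ring.
Qed.

(** The first hypothesis is the vanishing of [normal_part], unfolded with the metric coefficients
    abstracted; in the conformal case the Gram system is diagonal and is solved by dividing by
    [E]. *)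
Lemma tangent_combination (R : realType) (E F G : R) (x x1 x2 : 'rV[R]_4) :
  x - (((mink x x1 * G - mink x x2 * F) / (E * G - F ^+ 2)) *: x1 +
       ((mink x x2 * E - mink x x1 * F) / (E * G - F ^+ 2)) *: x2) = 0 ->
  0 < E -> E = G -> F = 0 ->
  x = E^-1 *: (mink x1 x *: x1 + mink x2 x *: x2).
Proof.
move=> /eqP; rewrite subr_eq0 => /eqP Ex E0 EG F0; move: Ex.
rewrite -EG F0 !mulr0 !subr0 expr0n subr0 ![mink x _]minkC => {1}->.
have E1 : E != 0 by rewrite gt_eqF.
by rewrite scalerDr !scalerA; congr (_ *: _ + _ *: _); field.
Qed.

Lemma derive_mink (R : realType) (V : normedModType R)
    (X Y : V -> 'rV[R]_4) (w v : V) :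
  differentiable X w -> differentiable Y w ->
  'D_v (fun x => mink (X x) (Y x)) w =
    mink ('D_v X w) (Y w) + mink (X w) ('D_v Y w).
Proof.
move=> dX dY; have dXv : derivable X w v by exact: diff_derivable.
have dYv : derivable Y w v by exact: diff_derivable.
by have [_] := is_derive_mink dXv dYv.
Qed.

Section normal_section.
Variables (R : realType) (D : set (R * R)) (f N : R * R -> 'rV[R]_4).
Hypotheses (oD : open D) (df : twice_differentiable_on D f)
  (dN : twice_differentiable_on D N).
Hypothesis nN : forall w, D w -> is_normal f w (N w).

Let nearD w (P : R * R -> Prop) : D w -> (forall x, D x -> P x) ->
  \forall x \near w, P x.
Proof. by move=> Dw DP; have := open_nbhs_nbhs (conj oD Dw); exact: filterS. Qed.

(** Differentiate the relation between [N] and the tangent vector ['D_v f], whose product is zero on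
    all of [D], in direction [u]. *)
Lemma mink_second_derive w u v : D w -> differentiable ('D_v f) w ->
  mink ('D_u ('D_v f) w) (N w) = - mink ('D_v f w) ('D_u N w).
Proof.
move=> Dw dv; have [dN0 _ _] := dN Dw; apply/eqP.
rewrite -addr_eq0 -derive_mink //; apply/eqP.
rewrite -(derive_cst (0 : R) w u); apply: near_eq_derive.
by apply: (nearD Dw) => x Dx; rewrite minkC nN.
Qed.

(** Self-adjointness of the shape operator of [N], a consequence of the symmetry of the second
    derivatives of [f]. *)
Lemma mink_mixed w : D w ->
  mink ('D_e1 f w) ('D_e2 N w) = mink ('D_e2 f w) ('D_e1 N w).
Proof.
move=> Dw; have [_ d1 d2] := df Dw.
have E1 := mink_second_derive e2 Dw d1.
have := mink_second_derive e1 Dw d2.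
by rewrite (twice_differentiable_comm oD df Dw) E1 => /oppr_inj.
Qed.

Hypothesis conf : forall w, D w -> metric f w e1 e1 = metric f w e2 e2 /\
  metric f w e1 e2 = 0.
Hypothesis pos : forall w, D w -> 0 < metric f w e1 e1.
Hypothesis harm : forall w, D w ->
  mink ('D_e1 ('D_e1 f) w) (N w) + mink ('D_e2 ('D_e2 f) w) (N w) = 0.
Hypothesis par : forall w v, D w -> normal_conn f v N w = 0.

(** By [harm], which is orthogonality of [N] to the mean curvature vector in conformal coordinates,
    the shape operator of [N] is trace-free. *)
Lemma trace_shape w : D w ->
  mink ('D_e2 f w) ('D_e2 N w) = - mink ('D_e1 f w) ('D_e1 N w).
Proof.
have alg (x y a b : R) : x + y = 0 -> x = - a -> y = - b -> b = - a.
  by move=> h hx hy; lra.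
move=> Dw; have [_ d1 d2] := df Dw.
exact: alg (harm Dw) (mink_second_derive e1 Dw d1) (mink_second_derive e2 Dw d2).
Qed.

Lemma parallel_tangent w v : D w ->
  'D_v N w = (metric f w e1 e1)^-1 *: (mink ('D_e1 f w) ('D_v N w) *: 'D_e1 f w +
    mink ('D_e2 f w) ('D_v N w) *: 'D_e2 f w).
Proof.
move=> Dw; have [E F] := conf Dw.
exact: tangent_combination (par v Dw) (pos Dw) E F.
Qed.

(** These are the derivatives of [E = G] and of [F = 0]. *)
Lemma conformal_derive w v : D w ->
  mink ('D_v ('D_e1 f) w) ('D_e1 f w) = mink ('D_v ('D_e2 f) w) ('D_e2 f w) /\
  mink ('D_v ('D_e1 f) w) ('D_e2 f w) = - mink ('D_v ('D_e2 f) w) ('D_e1 f w).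
Proof.
move=> Dw; have [_ d1 d2] := df Dw; split.
  have E : 'D_v (fun x => mink ('D_e1 f x) ('D_e1 f x)) w =
           'D_v (fun x => mink ('D_e2 f x) ('D_e2 f x)) w.
    by apply: near_eq_derive; apply: (nearD Dw) => x Dx; exact: (conf Dx).1.
  apply: mink_polar.
  exact: etrans (esym (derive_mink v d1 d1)) (etrans E (derive_mink v d2 d2)).
have E : 'D_v (fun x => mink ('D_e1 f x) ('D_e2 f x)) w = 0.
  rewrite -(derive_cst (0 : R) w v); apply: near_eq_derive.
  by apply: (nearD Dw) => x Dx; exact: (conf Dx).2.
have alg (x y : 'rV[R]_4) (a : R) : a + mink x y = 0 -> a = - mink y x.
  by rewrite minkC => h; lra.
exact: alg (etrans (esym (derive_mink v d1 d2)) E).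
Qed.

(** With [l_ij] the product of [f_i] and [N_j], these are the Cauchy-Riemann equations for
    [l_11 - i l_21]. In the product rule the terms with second derivatives of [N] match by symmetry,
    those with second derivatives of [f] by [codazzi_algebra]. *)
Lemma codazzi w : D w ->
  'D_e2 (fun x => mink ('D_e1 f x) ('D_e1 N x)) w =
    'D_e1 (fun x => mink ('D_e2 f x) ('D_e1 N x)) w /\
  'D_e1 (fun x => mink ('D_e1 f x) ('D_e1 N x)) w =
    - 'D_e2 (fun x => mink ('D_e2 f x) ('D_e1 N x)) w.
Proof.
move=> Dw; have [_ d1 d2] := df Dw; have [_ D1 D2] := dN Dw.
have cf := twice_differentiable_comm oD df Dw.
have cN := twice_differentiable_comm oD dN Dw.
have [C1 C2] := conformal_derive e1 Dw; have [C3 C4] := conformal_derive e2 Dw.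
have cfm y := congr1 (fun x => mink x y) cf.
have alg (x y : R) : x = - y -> y = - x by move=> ->; rewrite opprK.
have add_eq (x x' y y' : R) : x = x' -> y = y' -> x + y = x' + y' by move=> -> ->.
have [A1 A2] := codazzi_algebra (parallel_tangent e1 Dw)
  (parallel_tangent e2 Dw) (mink_mixed Dw) (trace_shape Dw)
  (etrans C1 (cfm _)) (etrans C2 (congr1 -%R (cfm _))) (esym C3) (alg _ _ C4).
(* Before differentiating along [e1], [l_21] is replaced by [l_12] and, in [B2], [l_11] by [- l_22];
   only then do the second derivatives of [N] on the two sides agree. *)
have B1 : 'D_e1 (fun x => mink ('D_e2 f x) ('D_e1 N x)) w =
          'D_e1 (fun x => mink ('D_e1 f x) ('D_e2 N x)) w.
  by apply: near_eq_derive; apply: (nearD Dw) => x Dx; exact: esym (mink_mixed Dx).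
have B2 : 'D_e1 (fun x => mink ('D_e1 f x) ('D_e1 N x)) w =
          'D_e1 (- (fun x => mink ('D_e2 f x) ('D_e2 N x))) w.
  apply: near_eq_derive; apply: (nearD Dw) => x Dx.
  exact: alg (trace_shape Dx).
split.
  apply: etrans (derive_mink e2 d1 D1) (esym (etrans B1 _)).
  apply: etrans (derive_mink e1 d1 D2) _.
  exact: add_eq (esym A1) (congr1 (mink ('D_e1 f w)) cN).
have dh : derivable (fun x => mink ('D_e2 f x) ('D_e2 N x)) w e1.
  by apply: diff_derivable; exact: differentiable_mink.
have S := etrans (derive_mink e1 d2 D2) (etrans
  (add_eq _ _ _ _ (etrans (cfm _) A2) (congr1 (mink ('D_e2 f w)) cN))
  (esym (derive_mink e2 d2 D1))).
exact: etrans B2 (etrans (deriveN dh) (congr1 -%R S)).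
Qed.

End normal_section.

(** * Charts, mean curvature and the coefficient of the quadratic differential *)

Lemma open_chart_img (R : realType) (T : topologicalType) (c : chart R T)
    (W : set T) : is_chart c -> open W -> open (chart_img c W).
Proof.
move=> [_ oI pc _ cp] oW; rewrite openE => w [x [cx Wx] <-].
have Iw : chart_img c setT (Defs.coord c x) by exists x.
have nI := open_nbhs_nbhs (conj oI Iw).
have nW : \forall y \near Defs.coord c x, W (param c y).
  by apply: (cp _ Iw); rewrite pc //; exact: open_nbhs_nbhs.
apply: filterS2 nI nW => y [x' [cx' _] <-]; rewrite pc // => Wx'.
by exists x'.
Qed.

Lemma chart_imgS (R : realType) (T : topologicalType) (c : chart R T)
    (W W' : set T) : W `<=` W' -> chart_img c W `<=` chart_img c W'.
Proof. by move=> WW w [x [cx /WW Wx] <-]; exists x. Qed.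

Lemma mink_complexify (R : realType) (a b x : 'rV[R]_4) :
  mink (\row_j Complex (a 0 j) (b 0 j)) (complexify x) =
    Complex (mink a x) (mink b x).
Proof.
apply/eqP; rewrite eq_complex /mink !big_ord_recl !big_ord0 !mxE /=.
by apply/andP; split; apply/eqP; ring.
Qed.

Lemma mink_combination (R : realType) (a b : R) (x y n : 'rV[R]_4) :
  mink n x = 0 -> mink n y = 0 -> mink (a *: x + b *: y) n = 0.
Proof. by move=> nx ny; rewrite minkC minkDr !minkZr nx ny !mulr0 addr0. Qed.

Lemma mink_tangent_part (R : realType) (f : R * R -> 'rV[R]_4) (w : R * R)
    (x n : 'rV[R]_4) : is_normal f w n -> mink (tangent_part f w x) n = 0.
Proof. by move=> nn; exact: mink_combination (nn e1) (nn e2). Qed.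

Lemma mink_normal_part (R : realType) (f : R * R -> 'rV[R]_4) (w : R * R)
    (x n : 'rV[R]_4) : is_normal f w n -> mink (normal_part f w x) n = mink x n.
Proof.
by move=> nn; rewrite minkDl minkNl (mink_tangent_part _ nn) oppr0 addr0.
Qed.

(** Pairing the mean curvature formula with the null vector [n] kills the right side; for a
    conformal metric the mixed term drops out and a nonzero multiple of the trace remains. *)
Lemma mean_curvature_null (R : realType) (E F G k : R) (x y z n : 'rV[R]_4) :
  (2 * (E * G - F ^+ 2))^-1 *: (G *: x - (2 * F) *: y + E *: z) = k *: n ->
  mink n n = 0 -> E = G -> F = 0 -> 0 < E -> mink x n + mink z n = 0.
Proof.
move=> H n0 EG F0 E0; have := congr1 (mink n) H.
rewrite -EG F0 mulr0 scale0r subr0 expr0n subr0 !minkZr minkDr !minkZr n0 mulr0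
  -mulrDr.
have E1 : E != 0 by rewrite gt_eqF.
rewrite ![mink n _]minkC => /eqP; rewrite !mulf_eq0 invr_eq0 !mulf_eq0 (negbTE E1).
by rewrite pnatr_eq0 /= => /eqP.
Qed.

Lemma derive_pair (R : realType) (V : normedModType R) (a b : V -> R) (w v : V) :
  differentiable a w -> differentiable b w ->
  'D_v (fun x => (a x, b x)) w = ('D_v a w, 'D_v b w).
Proof.
move=> da db; rewrite deriveE; last exact: differentiable_pair.
by rewrite diff_pair // !deriveE.
Qed.

Lemma near_ofC (R : realType) (D : set (R * R)) (z : R[i]) : open D ->
  D (ofC z) -> \forall y \near (z : R[i]^o), D (ofC y).
Proof.
move=> oD Dz; have /nbhs_normP [r /= r0 H] := open_nbhs_nbhs (conj oD Dz).
apply/nbhs_normP; exists r%:C%C; first by rewrite /= ltcR.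
move=> y /= zy; apply: H => /=; rewrite -ltcR; apply: le_lt_trans zy.
have -> : ofC z - ofC y = ofC (z - y) by case: (z); case: (y).
exact: norm_ofC_le.
Qed.

(** The row [r] is the shape of [dzz], and the left side depends on the frame vectors [x], [y] only
    through the sum [x + y]. *)
Lemma hopf_algebra (R : realType) (x11 x22 x12 x y : 'rV[R]_4) (l11 l22 l21 : R) :
  mink x11 (x + y) = - l11 -> mink x22 (x + y) = - l22 ->
  mink x12 (x + y) = - l21 ->
  let r : 'rV[R[i]]_4 := \row_j Complex ((x11 0 j - x22 0 j) / 4) (- (x12 0 j / 2)) in
  - mink r (complexify y) - mink r (complexify x) =
    Complex ((l11 - l22) / 4) (- (l21 / 2)).
Proof.
move=> E11 E22 E12 r.
have -> : r = \row_j Complex ((4^-1 *: (x11 - x22)) 0 j) ((- 2^-1 *: x12) 0 j).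
  by apply/rowP => j; rewrite !mxE; congr Complex; ring.
rewrite !mink_complexify !minkZl !minkDl !minkNl.
move: E11 E22 E12; rewrite !minkDr => E11 E22 E12.
by apply/eqP; rewrite eq_complex /=; apply/andP; split; apply/eqP; lra.
Qed.

Lemma tangent_partD (R : realType) (f : R * R -> 'rV[R]_4) (w : R * R)
    (x y : 'rV[R]_4) :
  tangent_part f w (x + y) = tangent_part f w x + tangent_part f w y.
Proof.
have alg (E F G g : R) (x1 x2 : 'rV[R]_4) :
  ((mink (x + y) x1 * G - mink (x + y) x2 * F) / g) *: x1 +
  ((mink (x + y) x2 * E - mink (x + y) x1 * F) / g) *: x2 =
  (((mink x x1 * G - mink x x2 * F) / g) *: x1 +
   ((mink x x2 * E - mink x x1 * F) / g) *: x2) +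
  (((mink y x1 * G - mink y x2 * F) / g) *: x1 +
   ((mink y x2 * E - mink y x1 * F) / g) *: x2).
  rewrite !minkDl [RHS]addrACA -!scalerDl.
  by congr (_ *: _ + _ *: _); rewrite [RHS]mulrC mulrC; congr (_ * _); ring.
exact: alg.
Qed.

Lemma normal_partD (R : realType) (f : R * R -> 'rV[R]_4) (w : R * R)
    (x y : 'rV[R]_4) :
  normal_part f w (x + y) = normal_part f w x + normal_part f w y.
Proof. by rewrite /normal_part tangent_partD opprD addrACA. Qed.

(** The last two hypotheses are the Cauchy-Riemann equations for [h / 2 - i k / 2]. *)
Lemma derivable_hopf (R : realType) (h k : R * R -> R) (z : R[i]) :
  differentiable h (ofC z) -> differentiable k (ofC z) ->
  'D_e2 h (ofC z) = 'D_e1 k (ofC z) -> 'D_e1 h (ofC z) = - 'D_e2 k (ofC z) ->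
  derivable ((fun y => Complex (h (ofC y) / 2) (- (k (ofC y) / 2)))
    : R[i]^o -> R[i]^o) z 1.
Proof.
set w := ofC z => dh dk C1 C2.
pose a := 2^-1 *: h; pose b := - 2^-1 *: k.
have da : differentiable a w by exact: differentiableZ.
have db : differentiable b w by exact: differentiableZ.
have Da v : 'D_v a w = 2^-1 * 'D_v h w by rewrite deriveZ //; exact: diff_derivable.
have Db v : 'D_v b w = - 2^-1 * 'D_v k w by rewrite deriveZ //; exact: diff_derivable.
have [Hd _] : is_derive (z : R[i]^o) 1
    ((fun y => toC ((fun x => (a x, b x)) (ofC y))) : R[i]^o -> R[i]^o)
    (toC ('D_e1 (fun x => (a x, b x)) (ofC z))).
  apply: cauchy_riemann_is_derive; first exact: differentiable_pair.
    by rewrite !derive_pair //= Da Db C2; ring.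
  by rewrite !derive_pair //= Da Db C1; ring.
rewrite [X in derivable X](_ : _ = (fun y => toC (a (ofC y), b (ofC y)))) //.
apply/funext => y; rewrite /toC /a /b /= !fctE /GRing.scale /=.
by congr Complex; ring.
Qed.

(** * The null normal field of a parallel frame *)

Section surface.
Variables (R : realType) (T : topologicalType) (A : set (chart R T))
  (psi : T -> 'rV[R]_4) (s : bool) (W : set T) (eta etat : T -> 'rV[R]_4).
Hypotheses (hsurf : connected_oriented_surface A)
  (hspace : spacelike_surface A psi)
  (horient : trapped_orientation A psi s)
  (hW : open W)
  (hframe : parallel_normal_frame A psi s W eta etat).
Variables (c : chart R T) (Ac : A c).

Let f : R * R -> 'rV[R]_4 := psi \o param c.
Let N : R * R -> 'rV[R]_4 := (eta \o param c) + (etat \o param c).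
Let D : set (R * R) := chart_img c W.

Let DT : D `<=` chart_img c setT.
Proof. exact: chart_imgS. Qed.

Lemma open_domain : open D.
Proof.
have [_ _ _ [cA _ _ _]] := hsurf.
exact: open_chart_img (cA c Ac) hW.
Qed.

Lemma twice_param : twice_differentiable_on D f.
Proof. exact: smooth_on_twice DT (hspace Ac).1. Qed.

Lemma twice_frame_sum : twice_differentiable_on D N.
Proof.
have [se st _ _] := hframe Ac.
apply: (twice_differentiable_onD open_domain).
  exact: smooth_on_twice se.
exact: smooth_on_twice st.
Qed.

Lemma normal_frame_sum w : D w -> is_normal f w (N w).
Proof.
move=> Dw v; have [_ _ /(_ w Dw) [[n1 n2] _ _ _ _] _] := hframe Ac.
have alg (x y z : 'rV[R]_4) : mink x z = 0 -> mink y z = 0 -> mink (x + y) z = 0.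
  by rewrite minkDl => -> ->; rewrite addr0.
exact: alg (n1 v) (n2 v).
Qed.

Lemma null_frame_sum w : D w -> mink (N w) (N w) = 0.
Proof.
move=> Dw; have [_ _ /(_ w Dw) [_ n1 n2 [n3 _] _] _] := hframe Ac.
have alg (x y : 'rV[R]_4) : mink x x = 1 -> mink x y = 0 -> mink y y = -1 ->
    mink (x + y) (x + y) = 0.
  by move=> xx xy yy; rewrite !minkDl !minkDr (minkC y x) xx xy yy; ring.
exact: alg n1 n2 n3.
Qed.

Lemma parallel_frame_sum w v : D w -> normal_conn f v N w = 0.
Proof.
move=> Dw; have [se st _ /(_ w Dw v) [p1 p2]] := hframe Ac.
have [d1 _ _] := smooth_on_twice (@subset_refl _ _) se Dw.
have [d2 _ _] := smooth_on_twice (@subset_refl _ _) st Dw.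
have dv1 : derivable (eta \o param c) w v by exact: diff_derivable.
have dv2 : derivable (etat \o param c) w v by exact: diff_derivable.
apply: etrans (congr1 (normal_part f w) (deriveD dv1 dv2)) _.
apply: etrans (normal_partD _ _ _ _) _.
have alg (x y : 'rV[R]_4) : x = 0 -> y = 0 -> x + y = 0.
  by move=> -> ->; rewrite addr0.
exact: alg p1 p2.
Qed.

(** This holds in every chart of [A], so [l_11 - l_22] is kept; the form serves both the
    transformation law and, combined with the trace condition, holomorphy. *)
Lemma Q_coefE z : D (ofC z) ->
  Q_coef psi eta etat c z =
    Complex ((mink ('D_e1 f (ofC z)) ('D_e1 N (ofC z)) -
              mink ('D_e2 f (ofC z)) ('D_e2 N (ofC z))) / 4)
            (- (mink ('D_e2 f (ofC z)) ('D_e1 N (ofC z)) / 2)).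
Proof.
move=> Dz; have [_ d1 d2] := twice_param Dz.
have S u v (d : differentiable ('D_v f) (ofC z)) :=
  mink_second_derive open_domain twice_frame_sum normal_frame_sum u Dz d.
have H := @hopf_algebra R _ _ _ (eta (param c (ofC z))) (etat (param c (ofC z)))
  _ _ _ (S e1 _ d1) (S e2 _ d2) (S e1 _ d2).
rewrite /Q_coef /pt_coef /p_coef /dzz.
move: H; exact.
Qed.

Lemma metric_pos w : D w -> 0 < metric f w e1 e1.
Proof.
move=> /DT Dw; apply: (hspace Ac).2 => //.
by apply/eqP => -[] /eqP; rewrite oner_eq0.
Qed.

Hypothesis conf : conformal psi c.

(** The mean curvature is a multiple of the null field [N], and since [N] is normal, second
    derivatives may replace the second fundamental form. *)
Lemma trapped_harmonic w : D w ->
  mink ('D_e1 ('D_e1 f) w) (N w) + mink ('D_e2 ('D_e2 f) w) (N w) = 0.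
Proof.
move=> Dw; have [_ _ /(_ w Dw) on _] := hframe Ac.
have [k H] := horient Ac (DT Dw) on.
have [EG F] := conf (DT Dw).
have := mean_curvature_null H (null_frame_sum Dw) EG F (metric_pos Dw).
have nN := normal_frame_sum Dw.
have alg (x y x' y' : R) : x = x' -> y = y' -> x + y = 0 -> x' + y' = 0.
  by move=> -> ->.
exact: alg (mink_normal_part _ nN) (mink_normal_part _ nN).
Qed.

Lemma holomorphic_Q z : D (ofC z) ->
  derivable (Q_coef psi eta etat c : R[i]^o -> R[i]^o) z 1.
Proof.
move=> Dz; set w := ofC z in Dz.
have [_ d1 d2] := twice_param Dz; have [_ D1 D2] := twice_frame_sum Dz.
have confD x : D x -> metric f x e1 e1 = metric f x e2 e2 /\ metric f x e1 e2 = 0.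
  by move=> /DT; exact: conf.
have [C1 C2] := codazzi open_domain twice_param twice_frame_sum normal_frame_sum
  confD metric_pos trapped_harmonic parallel_frame_sum Dz.
have dh11 := differentiable_mink d1 D1; have dh21 := differentiable_mink d2 D1.
apply: near_eq_derivable (derivable_hopf dh11 dh21 C1 C2).
apply: filterS (near_ofC open_domain Dz) => y Dy.
(* The trace condition turns [(l_11 - l_22) / 4] into [l_11 / 2], the real part expected by
   [derivable_hopf]. *)
have tr := trace_shape open_domain twice_param twice_frame_sum normal_frame_sum
  trapped_harmonic Dy.
have alg (x1 x2 y1 : R) : x2 = - x1 ->
    Complex (x1 / 2) (- (y1 / 2)) = Complex ((x1 - x2) / 4) (- (y1 / 2)).
  by move=> ->; congr Complex; field.
have QE := Q_coefE Dy.
have alg2 := alg _ _ (mink ('D_e2 f (ofC y)) ('D_e1 N (ofC y))) tr.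
exact: etrans alg2 (esym QE).
Qed.

End surface.

(** * Change of conformal coordinates *)

Lemma derive_chain (R : realType) (V : normedModType R) (F F' : R * R -> V)
    (tau : R * R -> R * R) (w v : R * R) :
  (\forall x \near w, F' (tau x) = F x) ->
  differentiable tau w -> differentiable F' (tau w) ->
  'D_v F w = ('D_v tau w).1 *: 'D_e1 F' (tau w) +
             ('D_v tau w).2 *: 'D_e2 F' (tau w).
Proof.
move=> FF' dtau dF'; rewrite -derive_basis // -(near_eq_derive v FF').
rewrite [LHS]deriveE; last exact: (@differentiable_comp _ _ _ _ tau F').
by rewrite (@diff_comp _ _ _ _ tau F') // /= -deriveE // -deriveE.
Qed.

(* By Lagrange's identity a d - b c = a^2 + b^2 = c^2 + d^2, so that
   (a - d)^2 + (b + c)^2 = 0. *)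
Lemma conformal_algebra (R : realType) (a b c d : R) (x1 x2 : 'rV[R]_4) :
  mink x1 x1 = mink x2 x2 -> mink x1 x2 = 0 -> 0 < mink x1 x1 ->
  mink (a *: x1 + b *: x2) (a *: x1 + b *: x2) =
    mink (c *: x1 + d *: x2) (c *: x1 + d *: x2) ->
  mink (a *: x1 + b *: x2) (c *: x1 + d *: x2) = 0 ->
  0 < a * d - b * c -> a = d /\ b = - c.
Proof.
rewrite !minkDl !minkDr !minkZl !minkZr (minkC x2 x1) => <- ->.
move: (mink x1 x1) => l l0 EG F J.
have {}EG : a ^+ 2 + b ^+ 2 = c ^+ 2 + d ^+ 2.
  by apply: (mulfI (lt0r_neq0 l0)); lra.
have {}F : a * c + b * d = 0.
  by apply: (mulfI (lt0r_neq0 l0)); rewrite mulr0; lra.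
(* The squares agree by Lagrange's identity. Positivity of the Jacobian then fixes the sign, which
   rules out the antiholomorphic case. *)
have JS : a * d - b * c = a ^+ 2 + b ^+ 2.
  have S0 : 0 <= a ^+ 2 + b ^+ 2 by rewrite addr_ge0 ?sqr_ge0.
  apply/eqP; rewrite -(eqrXn2 (n := 2) isT (ltW J) S0); apply/eqP.
  transitivity ((a ^+ 2 + b ^+ 2) * (c ^+ 2 + d ^+ 2) - (a * c + b * d) ^+ 2).
    by ring.
  by rewrite F -EG; ring.
have : (a - d) ^+ 2 + (b + c) ^+ 2 = 0.
  transitivity ((a ^+ 2 + b ^+ 2) + (c ^+ 2 + d ^+ 2) - 2 * (a * d - b * c)).
    by ring.
  by rewrite JS -EG; ring.
move=> /eqP; rewrite paddr_eq0 ?sqr_ge0 // !sqrf_eq0 subr_eq0 addr_eq0.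
by move=> /andP[/eqP -> /eqP ->].
Qed.

(** By the symmetry hypothesis the coefficient is the complex-bilinear product of the
    [z]-derivatives of the surface and of the normal field. Each of these is multiplied by [a + i b]
    under the change of coordinate, whence the square. *)
Lemma hopf_transition_algebra (R : realType) (a b c d : R)
    (x1 x2 m1 m2 y1 y2 n1 n2 : 'rV[R]_4) :
  a = d -> b = - c ->
  y1 = a *: x1 + b *: x2 -> y2 = c *: x1 + d *: x2 ->
  n1 = a *: m1 + b *: m2 -> n2 = c *: m1 + d *: m2 ->
  mink x1 m2 = mink x2 m1 ->
  Complex ((mink y1 n1 - mink y2 n2) / 4) (- (mink y2 n1 / 2)) =
  Complex ((mink x1 m1 - mink x2 m2) / 4) (- (mink x2 m1 / 2)) *
    Complex a b ^+ 2.
Proof.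
move=> -> -> -> -> -> -> M; rewrite !minkDl !minkDr !minkZl !minkZr M expr2.
by apply/eqP; rewrite eq_complex /=; apply/andP; split; apply/eqP; field.
Qed.

Lemma toCK (R : realType) (w : R * R) : ofC (toC w) = w.
Proof. by case: w. Qed.

Theorem lemma5 (R : realType) (T : topologicalType) (A : set (chart R T))
  (psi : T -> 'rV[R]_4) (s : bool) (W : set T) (eta etat : T -> 'rV[R]_4)
  (hsurf : connected_oriented_surface A)
  (hspace : spacelike_surface A psi)
  (htrapped : marginally_trapped A psi)
  (horient : trapped_orientation A psi s)
  (hflat : flat_normal_bundle A psi)
  (hW : open W)
  (hframe : parallel_normal_frame A psi s W eta etat) :
  holomorphic_quadratic_differential A psi W (Q_coef psi eta etat).
Proof.
split; last first.
  move=> c Ac conf z Dz.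
  exact: (holomorphic_Q hsurf hspace horient hW hframe Ac conf).
move=> c c' Ac Ac' conf conf' z Dz.
have [_ _ _ [charts _ trans _]] := hsurf.
have [od' _ pc' _ _] := charts _ Ac'; have [_ _ pc _ _] := charts _ Ac.
have [stau jtau] := trans _ _ Ac Ac'.
pose D := chart_img c (dom c' `&` W).
have oD : open D by apply: open_chart_img (charts _ Ac) (openI od' hW).
have DW : D `<=` chart_img c W by apply: chart_imgS => x [].
have Dd : D `<=` chart_img c (dom c') by apply: chart_imgS => x [].
pose tau := Defs.coord c' \o param c.
have tauD x : D x -> chart_img c' W (tau x) /\ param c' (tau x) = param c x.
  move=> [y [cy [c'y Wy]] <-]; rewrite /tau /= pc // pc' //; split => //.
  by exists y.
set w := ofC z in Dz.
have nD : \forall x \near w, D x by exact: open_nbhs_nbhs (conj oD Dz).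
have [dtau _ _] := smooth_on_twice Dd stau Dz.
have [D'w pw] := tauD w Dz.
pose f := psi \o param c; pose f' := psi \o param c'.
pose N := (eta \o param c) + (etat \o param c).
pose N' := (eta \o param c') + (etat \o param c').
(* The identity is available only on the overlap, since chart maps take arbitrary values elsewhere;
   [derive_chain] therefore asks for it near [w]. *)
have ff' : \forall x \near w, f' (tau x) = f x.
  by apply: filterS nD => x Dx; rewrite /f' /f /= (tauD x Dx).2.
have NN' : \forall x \near w, N' (tau x) = N x.
  by apply: filterS nD => x Dx; rewrite /N' /N /= !fctE /= (tauD x Dx).2.
have df' := twice_param (W := W) hspace Ac'.
have dN' := twice_frame_sum hsurf hW hframe Ac'.
have [df0 _ _] := df' _ D'w; have [dN0 _ _] := dN' _ D'w.
have fc v := derive_chain v ff' dtau df0.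
have Nc v := derive_chain v NN' dtau dN0.
have sub V : chart_img c V `<=` chart_img c setT by exact: chart_imgS.
have sub' V : chart_img c' V `<=` chart_img c' setT by exact: chart_imgS.
have [EG' F'] := conf' _ (sub' _ _ D'w).
have [EG F] := conf _ (sub _ _ Dz).
have pos := metric_pos hspace Ac' D'w.
have JP := jtau _ (Dd _ Dz).
(* Conformality of [c], rewritten by the chain rule in the coordinate basis of [c'], becomes a
   condition on the Jacobian matrix of [tau]. *)
have EG2 := etrans (esym (congr2 (@mink R) (fc e1) (fc e1)))
  (etrans EG (congr2 (@mink R) (fc e2) (fc e2))).
have F2 := etrans (esym (congr2 (@mink R) (fc e1) (fc e2))) F.
have [CR1 CR2] := conformal_algebra EG' F' pos EG2 F2 JP.
have Qw := Q_coefE hsurf hspace hW hframe Ac (DW _ Dz).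
have := Q_coefE hsurf hspace hW hframe Ac' (z := toC (tau w)).
rewrite toCK => /(_ D'w) Qw'.
have M := mink_mixed (open_domain hsurf hW Ac') df' dN'
  (normal_frame_sum hframe Ac') D'w.
have Hopf := hopf_transition_algebra CR1 CR2 (fc e1) (fc e2) (Nc e1) (Nc e2) M.
(* The factor [a + i b] of [Hopf] is thereby identified with the complex derivative of the
   transition. *)
have [_ Dtau] := cauchy_riemann_is_derive dtau CR1 CR2.
have mul_eq (x x' y y' : R[i]) : x = x' -> y = y' -> x * y ^+ 2 = x' * y' ^+ 2.
  by move=> -> ->.
exact: etrans Qw (etrans Hopf (mul_eq _ _ _ _ (esym Qw') (esym Dtau))).
Qed.
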